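(* Let $n>2$ be an integer and $r\ge1$ an integer with $2^r+1<2^n$, and let $S=P_{2^r+1}(n)$. Then $S$ satisfies Wilf's inequality: $\mathrm{F}(S)+1\le \mathrm{e}(S)\,\nu(S)$, where $\nu(S)=|\{s\in S\mid s\le \mathrm{F}(S)\}|$.
   Context: $P_{2^r+1}(n)$ is the numerical semigroup consisting of all finite non-negative integer linear combinations of $\{(2^r+1)2^{n+i}+1\mid i\in\mathbb{N}\}$. $\mathrm{F}(S)$ is the Frobenius number (largest integer not in $S$) and $\mathrm{e}(S)$ is the embedding dimension (cardinality of the unique minimal system of generators of $S$). *)

(* Defs.v *)
From mathcomp Require Import all_boot all_order all_algebra finmap zify.
From mathcomp Require Import all_classical.

Set Implicit Arguments.
Unset Strict Implicit.
Unset Printing Implicit Defensive.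

Import Order.TTheory GRing.Theory Num.Theory.
Local Open Scope classical_set_scope.

Record numSemigroup := NumSemigroup {
  ns_set :> set nat;
  ns_0 : ns_set 0;
  ns_add : forall x y, ns_set x -> ns_set y -> ns_set (x + y);
  ns_cofinite : finite_set (~` ns_set)
}.

Definition monoid_span (A : set nat) : set nat :=
  [set x | exists (m : nat) (c a : 'I_m -> nat),
     (forall i, A (a i)) /\ x = \sum_(i < m) c i * a i].

(* The largest integer outside S; it is -1 when S is all of nat. *)
Definition is_frobenius (S : set nat) (f : int) : Prop :=
  (forall s, S s -> Posz s <> f) /\
  (forall z : int, (f < z)%R -> exists2 s, S s & Posz s = z).

(* The default values of xget and of fset_set (on infinite sets) are never
   reached: see frobeniusP, frobenius_unique, minimal_generatorsP,
   minimal_generators_unique, minimal_generators_finite, wilf_nu_finite. *)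
Definition frobenius (S : numSemigroup) : int :=
  xget (0 : int)%R [set f | is_frobenius S f].

Definition is_minimal_generators (S A : set nat) : Prop :=
  monoid_span A = S /\ forall B, B `<` A -> monoid_span B <> S.

Definition minimal_generators (S : numSemigroup) : set nat :=
  xget set0 [set A | is_minimal_generators S A].

Definition embedding_dim (S : numSemigroup) : nat :=
  #|` fset_set (minimal_generators S)|.

Definition wilf_nu (S : numSemigroup) : nat :=
  #|` fset_set [set s : nat | ns_set S s /\ (Posz s <= frobenius S)%R]|.

Lemma monoid_span_sub (A : set nat) : A `<=` monoid_span A.
Proof.
move=> x Ax; exists 1, (fun=> 1), (fun=> x); split=> //.
by rewrite big_ord1 mul1n.
Qed.

Lemma monoid_span0 (A : set nat) : monoid_span A 0.
Proof. by exists 0, (fun=> 0), (fun=> 0); split; [case|rewrite big_ord0]. Qed.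

Lemma monoid_spanD (A : set nat) x y :
  monoid_span A x -> monoid_span A y -> monoid_span A (x + y).
Proof.
move=> [m [c [a [Aa ->]]]] [m' [c' [a' [Aa' ->]]]].
pose pick T (f : 'I_m -> T) (g : 'I_m' -> T) (i : 'I_(m + m')) :=
  match fintype.split i with inl j => f j | inr j => g j end.
exists (m + m'), (pick _ c c'), (pick _ a a'); split.
  by move=> i; rewrite /pick; case: (fintype.split i).
rewrite big_split_ord /=; congr (_ + _); apply: eq_bigr => i _; rewrite /pick.
  by rewrite -[lshift _ _]/(unsplit (inl i)) unsplitK.
by rewrite -[rshift _ _]/(unsplit (inr i)) unsplitK.
Qed.

Lemma monoid_spanM (A : set nat) k x : monoid_span A x -> monoid_span A (k * x).
Proof.
move=> Ax; elim: k => [|k IH]; first exact: monoid_span0.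
by rewrite mulSn; apply: monoid_spanD.
Qed.

Lemma monoid_span_min (A S : set nat) :
  S 0 -> (forall x y, S x -> S y -> S (x + y)) -> A `<=` S ->
  monoid_span A `<=` S.
Proof.
move=> S0 SD AS x [m [c [a [Aa ->]]]]; apply: (big_ind S) => // i _.
elim: (c i) => [//|k IH]; rewrite mulSn; apply: SD => //; exact: AS.
Qed.

Lemma frobenius_ex (S : numSemigroup) : exists f, is_frobenius S f.
Proof.
have [M HM] : exists M : nat, forall x, M <= x -> ns_set S x.
  have [s sE] := (finite_seqP _).1 (ns_cofinite S).
  exists (\max_(x <- s) x).+1 => x Mx; apply: contrapT => nSx.
  have : (~` ns_set S) x by [].
  rewrite sE /= => xs.
  by have := @leq_bigmax_seq _ s predT id x xs isT; rewrite /= leqNgt Mx.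
elim: M HM => [|M IH] HM.
  exists (-1)%R; split=> [s _|z]; first by lia.
  by case: z => [z|z] zlt; [exists z => //; apply: HM | lia].
have [SM|nSM] := EM (ns_set S M).
  by apply: IH => x; rewrite leq_eqVlt => /orP[/eqP<-//|]; apply: HM.
exists (Posz M); split=> [s Ss [sM]|z]; first by apply: nSM; rewrite -sM.
by case: z => [z|z] zlt; [exists z => //; apply: HM; lia | lia].
Qed.

Lemma frobenius_unique (S : set nat) f g :
  is_frobenius S f -> is_frobenius S g -> f = g.
Proof.
move=> [f1 f2] [g1 g2]; case: (ltgtP f g) => // fg.
  by have [s Ss /(g1 _ Ss)] := f2 _ fg.
by have [s Ss /(f1 _ Ss)] := g2 _ fg.
Qed.

Lemma frobeniusP (S : numSemigroup) : is_frobenius S (frobenius S).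
Proof. exact: (xgetPex (0 : int)%R (frobenius_ex S)). Qed.

Definition irreducibles (S : set nat) : set nat :=
  [set x | S x /\ x <> 0 /\
     forall y z, S y -> S z -> x = y + z -> y = 0 \/ z = 0].

Lemma irreducibles_sub (S A : set nat) :
  monoid_span A = S -> irreducibles S `<=` A.
Proof.
move=> AS x [Sx [x0 xirr]].
have : monoid_span A x by rewrite AS.
move=> [m [c [a [Aa xE]]]].
have SA k i : S (k * a i).
  by rewrite -AS; apply: monoid_spanM; apply: monoid_span_sub.
have [i ci] : exists i, c i * a i <> 0.
  apply: contrapT => H; apply: x0; rewrite xE big1 // => i _.
  by apply: contrapT => ?; apply: H; exists i.
have rest : S (\sum_(j < m | j != i) c j * a j).
  apply: (big_ind S) => [|u v|//]; rewrite -AS.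
    exact: monoid_span0.
  exact: monoid_spanD.
move: xE; rewrite (bigD1 i) //= => xE.
have [//|r0] := xirr _ _ (SA _ i) rest xE.
move: xE; rewrite r0 addn0.
case: (c i) ci => [|k] // ci xE.
have := xirr _ _ (SA 1 i) (SA k i).
rewrite mul1n -mulSn => /(_ xE) [a0|k0].
  by rewrite a0 muln0 in ci.
by rewrite xE mulSn k0 addn0.
Qed.

Lemma irreducibles_span (S : numSemigroup) : monoid_span (irreducibles S) = S.
Proof.
apply/seteqP; split.
  apply: monoid_span_min; [exact: ns_0|exact: ns_add|by move=> x []].
move=> x; have [k] := ubnP x; elim: k x => // k IH x xk Sx.
have [->|x0] := EM (x = 0); first exact: monoid_span0.
have [irr|] := EM (irreducibles S x); first exact: monoid_span_sub.
move=> nirr; apply: contrapT => nx; apply: nirr; split=> //; split=> //.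
move=> y z Sy Sz xE; apply: contrapT => yz; apply: nx; rewrite xE.
have y0 : y <> 0 by move=> ?; apply: yz; left.
have z0 : z <> 0 by move=> ?; apply: yz; right.
by apply: monoid_spanD; apply: IH => //; lia.
Qed.

Lemma minimal_generatorsE (S : numSemigroup) :
  minimal_generators S = irreducibles S.
Proof.
have irrP : is_minimal_generators S (irreducibles S).
  split; first exact: irreducibles_span.
  by move=> B [BS nSB] /irreducibles_sub.
have [AS Amin] : is_minimal_generators S (minimal_generators S).
  by apply: (@xgetPex _ set0 [set A | is_minimal_generators S A]); exists (irreducibles S).
have sub := irreducibles_sub AS.
apply: contrapT => neq; apply: (Amin (irreducibles S)) irrP.1; split=> // sub'.
by apply: neq; apply/seteqP.
Qed.

Lemma minimal_generatorsP (S : numSemigroup) :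
  is_minimal_generators S (minimal_generators S).
Proof.
rewrite minimal_generatorsE; split; first exact: irreducibles_span.
by move=> B [BS nSB] /irreducibles_sub.
Qed.

Lemma minimal_generators_unique (S : numSemigroup) A :
  is_minimal_generators S A -> A = minimal_generators S.
Proof.
move=> [AS Amin]; rewrite minimal_generatorsE.
have sub := irreducibles_sub AS.
apply: contrapT => neq.
apply: (Amin (irreducibles S)); last exact: irreducibles_span.
by split=> // sub'; apply: neq; apply/seteqP.
Qed.

Lemma minimal_generators_finite (S : numSemigroup) :
  finite_set (minimal_generators S).
Proof.
rewrite minimal_generatorsE.
have [f1 f2] := frobeniusP S; set f := frobenius S in f1 f2.
pose N := `|f|%N.+1.
have big x : N <= x -> ns_set S x.
  by move=> Nx; have [|s Ss [<-//]] := f2 (Posz x); rewrite /N in Nx; lia.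
apply: (@sub_finite_set _ _ `I_(N + N).+1); last exact: finite_II.
move=> x [Sx [x0 irr]] /=; rewrite ltnS leqNgt; apply/negP => xN.
have xE : x = N + (x - N) by lia.
have SN : ns_set S N by apply: big.
have SxN : ns_set S (x - N) by apply: big; lia.
by case: (irr _ _ SN SxN xE); rewrite /N in xN *; lia.
Qed.

Lemma wilf_nu_finite (S : numSemigroup) :
  finite_set [set s : nat | ns_set S s /\ (Posz s <= frobenius S)%R].
Proof.
apply: (@sub_finite_set _ _ `I_(`|frobenius S|%N).+1); last exact: finite_II.
by move=> s [_ /=]; lia.
Qed.

Definition proth_generators (k n : nat) : set nat :=
  [set x | exists i : nat, x = k * 2 ^ (n + i) + 1].

Lemma proth_cofinite k n :
  finite_set (~` monoid_span (proth_generators k n)).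
Proof.
pose a := k * 2 ^ n + 1.
have Pa : monoid_span (proth_generators k n) a.
  by apply: monoid_span_sub; exists 0; rewrite addn0.
have Pb : monoid_span (proth_generators k n) (2 * a - 1).
  apply: monoid_span_sub; exists 1; rewrite /a [n + 1]addn1 expnS mulnCA; lia.
have a0 : 0 < a by rewrite /a addn1.
apply: (@sub_finite_set _ _ `I_(2 * a * a)); last exact: finite_II.
move=> m /= nm; rewrite ltnNge; apply/negP => am; apply: nm.
have q2 : 2 * a <= m %/ a by rewrite leq_divRL.
have tlt : m %% a < a by rewrite ltn_mod.
suff -> : m = (m %/ a + 1 + 2 * (m %% a) - 2 * a) * a
              + (a - m %% a) * (2 * a - 1).
  by apply: monoid_spanD; apply: monoid_spanM.
rewrite {1}(divn_eq m a).
move: (m %/ a) (m %% a) q2 tlt => q t q2 tlt.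
have [d ->] : exists d, q = 2 * a + d by exists (q - 2 * a); lia.
have [u aE] : exists u, a = t + u.+1 by exists (a - t).-1; lia.
have -> : 2 * a + d + 1 + 2 * t - 2 * a = d + 1 + 2 * t by lia.
have -> : a - t = u.+1 by lia.
have -> : 2 * a - 1 = 2 * t + 2 * u + 1 by lia.
rewrite aE; nia.
Qed.

Definition proth_semigroup (k n : nat) : numSemigroup :=
  NumSemigroup (@monoid_span0 (proth_generators k n))
    (@monoid_spanD (proth_generators k n)) (@proth_cofinite k n).

(* Main.v *)
Require Import Defs.
From mathcomp Require Import all_boot all_order all_algebra.
From mathcomp Require Import finmap zify all_classical.

(**
   Put [k := 2 ^ r + 1], [M := k * 2 ^ n] and [m := M + 1], the least generator.
   The [i]-th generator is [(2 ^ i - 1) * M + m], so every element of [S] has the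
   form [T * M + C * m], where [T] is a sum of [C] "coins" of the form
   [2 ^ i - 1].  Since [M = -1] modulo [m], two such expressions of the same number
   have congruent [T]s; this makes the generators with [2 ^ i <= m]
   irreducible, so that [e(S) >= n + r + 1 =: e], and keeps [M ^ 2] out of [S].
   Conversely every [t < m] is a sum of at most [e] coins, so [S] contains
   [q * m - t] as soon as [t < m] and [t + e <= q].  Hence [F(S) < (M + e) * m],
   while [S] contains at least [(M - e) * (M - e + 1) / 2] numbers below [M ^ 2],
   and Wilf's inequality follows because [m >= 5 * e] and [e >= 5].
*)

Set Implicit Arguments.
Unset Strict Implicit.
Unset Printing Implicit Defensive.

Import Order.TTheory.
Local Open Scope classical_set_scope.

Lemma proth_generatorE k n i :
  k * 2 ^ (n + i) + 1 = (2 ^ i - 1) * (k * 2 ^ n) + (k * 2 ^ n).+1.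
Proof. by have := expn_gt0 2 i; rewrite expnD; nia. Qed.

(** The clause on [C = 0] says that no coins sum to zero; it turns [C = 0] into [x = 0]. *)
Lemma proth_span_decomp k n x (M := k * 2 ^ n) :
  monoid_span (proth_generators k n) x ->
  exists T C, x = T * M + C * M.+1 /\ (C = 0 -> T = 0).
Proof.
move: x; apply: monoid_span_min.
- by exists 0, 0.
- move=> x y [T [C [-> TC]]] [T' [C' [-> TC']]].
  exists (T + T'), (C + C'); split; first by rewrite !mulnDl; lia.
  by lia.
- move=> _ [i ->]; exists (2 ^ i - 1), 1; split=> //.
  by rewrite proth_generatorE mul1n.
Qed.

(* [M] is [-1] modulo [M + 1], so the coefficients of [M] are congruent. *)
Lemma proth_decomp_coef0 M t T C : t <= M ->
  t * M = T * M + C * M.+1 -> C = 0.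
Proof.
move=> tM E.
have [M0|Mpos] := posnP M; first by rewrite M0 in E; lia.
have Tt : T <= t by rewrite -(leq_pmul2r Mpos); lia.
have [d tE] : exists d, t = T + d by exists (t - T); lia.
move: E; rewrite tE mulnDl => E.
have {}E : d * M = C * M.+1 by lia.
have [//|Cpos] := posnP C.
have Cd : C < d by rewrite -(ltn_pmul2r Mpos) E mulnS; lia.
(* This yields [M <= C < d <= t], against [t <= M]. *)
by have := leq_mul Cd (leqnn M); rewrite E mulSn mulnS; lia.
Qed.

Lemma proth_gap k n (M := k * 2 ^ n) : 0 < M ->
  ~ monoid_span (proth_generators k n) (M * M).
Proof.
move=> Mpos /proth_span_decomp[T [C [E TC]]].
have C0 := proth_decomp_coef0 (leqnn M) E.
by move: E; rewrite (TC C0) C0 !mul0n => /eqP; rewrite muln_eq0 orbb -/M; lia.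
Qed.

Lemma proth_generator_irreducible k n i : 2 ^ i <= (k * 2 ^ n).+1 ->
  irreducibles (monoid_span (proth_generators k n)) (k * 2 ^ (n + i) + 1).
Proof.
move=> iM; split; first by apply: monoid_span_sub; exists i.
split; first by lia.
move=> y z /proth_span_decomp[T [C [yE TC]]] /proth_span_decomp[T' [C' [zE TC']]].
rewrite proth_generatorE => E.
have [C0|Cpos] := posnP C; first by left; rewrite yE TC // C0.
have [C'0|C'pos] := posnP C'; first by right; rewrite zE TC' // C'0.
have tM : 2 ^ i - 1 <= k * 2 ^ n by lia.
(* Two nonzero summands use at least two coins, a generator only one; cancel one copy of [m] on each
   side. *)
suff : (C + C').-1 = 0 by lia.
apply: (@proth_decomp_coef0 _ _ (T + T') _ tM).
move: E; rewrite yE zE.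
have -> : (C + C').-1 = C.-1 + C' by lia.
case: C Cpos {TC yE} => // C _ /=; rewrite !mulnDl mulSn; lia.
Qed.

(* Greedy coin change with the coins [2 ^ i - 1]. *)
Lemma proth_coins k n e t (M := k * 2 ^ n) : t < 2 ^ e - 1 ->
  exists2 c, c <= e & monoid_span (proth_generators k n) (t * M + c * M.+1).
Proof.
have gen i : monoid_span (proth_generators k n) ((2 ^ i - 1) * M + M.+1).
  by apply: monoid_span_sub; exists i; rewrite proth_generatorE.
elim: e t => [//|e IH] t; rewrite expnS => te.
have [lt|ge] := ltnP t (2 ^ e - 1).
  by have [c ce Sc] := IH _ lt; exists c; first by lia.
(* The one value for which removing a coin leaves a remainder outside the range of [IH]: two equal
   coins pay it, or none if [e = 0]. *)
have [->|neq] := eqVneq t (2 * (2 ^ e - 1)).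
  case: e ge te IH => [|e] ge te IH; first by exists 0 => //; exact: monoid_span0.
  exists 2; first by lia.
  by rewrite -mulnA -mulnDr; apply: monoid_spanM.
have [|c ce Sc] := IH (t - (2 ^ e - 1)); first by lia.
exists c.+1 => //.
have -> : t * M + c.+1 * M.+1
    = ((2 ^ e - 1) * M + M.+1) + ((t - (2 ^ e - 1)) * M + c * M.+1).
  by rewrite mulSn -{1}(subnK ge) mulnDl; lia.
exact: monoid_spanD.
Qed.

(** Since [t * M = t * m - t], the number is [t * M + (q - t) * m]: at most [e] of the [q - t]
    copies of [m] go with the coins for [t], the others stand alone. *)
Lemma proth_interval k n e q t (M := k * 2 ^ n) :
  M < 2 ^ e - 1 -> t <= M -> t + e <= q ->
  monoid_span (proth_generators k n) (q * M.+1 - t).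
Proof.
move=> Me tM tq.
have [c ce Sc] := @proth_coins k n e t (leq_ltn_trans tM Me).
have -> : q * M.+1 - t = (q - t - c) * M.+1 + (t * M + c * M.+1).
  have -> : q = (q - t - c) + t + c by lia.
  by move: (q - t - c) => d; rewrite !mulnDl; nia.
apply: monoid_spanD => //; apply: monoid_spanM.
by apply: monoid_span_sub; exists 0; rewrite addn0 addn1.
Qed.

Lemma proth_large k n e x (M := k * 2 ^ n) : M < 2 ^ e - 1 ->
  (M + e) * M.+1 <= x -> monoid_span (proth_generators k n) x.
Proof.
move=> Me xge.
have qge : M + e <= x %/ M.+1 by rewrite leq_divRL.
have rlt : x %% M.+1 < M.+1 by rewrite ltn_mod.
have [r0|rpos] := posnP (x %% M.+1).
  have -> : x = x %/ M.+1 * M.+1 - 0 by rewrite {1}(divn_eq x M.+1) r0 addn0 subn0.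
  by apply: (proth_interval Me) => //; lia.
have -> : x = (x %/ M.+1).+1 * M.+1 - (M.+1 - x %% M.+1).
  by rewrite {1}(divn_eq x M.+1) mulSn; lia.
by apply: (proth_interval Me); rewrite -/M; lia.
Qed.

Lemma fset_set_ge_size (T : choiceType) (A : set T) (s : seq T) :
  finite_set A -> uniq s -> (forall x, x \in s -> A x) ->
  size s <= #|` fset_set A|.
Proof.
move=> finA us sA; apply: uniq_leq_size => // x xs.
by rewrite in_fset_set // inE; exact: sA.
Qed.

Lemma triangle_bound M e : 5 <= e -> 5 * e <= M.+1 ->
  (M + e) * M.+1 <= e * 'C((M - e).+1, 2).
Proof.
move=> e5 M5.
have [d ME] : exists d, M = e + d by exists (M - e); lia.
have -> : M - e = d by lia.
have bin2E : 'C(d.+1, 2) * 2 = d.+1 * d by have := mul_bin_diag d.+1 1; rewrite bin1; lia.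
rewrite -(leq_pmul2r (isT : 0 < 2)) -[leqRHS]mulnA bin2E ME.
(* From [4 * e <= d.+1]; the product of [h1] and [h2] is four times the goal. *)
have h1 : 2 * (e + d + e) <= 4 * d by lia.
have h2 : 4 * (e + d).+1 <= e * d.+1 by nia.
by have := leq_mul h1 h2; nia.
Qed.

(** Each [j < d] contributes the [j.+1] consecutive elements ending at [(e + j) * m]. *)
Lemma proth_small_elements k n e d (M := k * 2 ^ n) :
  M < 2 ^ e - 1 -> e + d <= M ->
  exists s : seq nat, [/\ uniq s, size s = 'C(d.+1, 2) &
    forall x, x \in s ->
      monoid_span (proth_generators k n) x /\ x + M.+1 <= (e + d) * M.+1].
Proof.
move=> Me; elim: d => [|d IH] dM; first by exists [::].
have [|s [us ss sS]] := IH; first by lia.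
exists (s ++ iota ((e + d) * M.+1 - d) d.+1).
have dle : d <= (e + d) * M.+1 by rewrite mulnS; nia.
split.
- rewrite cat_uniq us iota_uniq andbT; apply/hasPn => x.
  rewrite mem_iota => xge; apply/negP => /sS[_ xle]; lia.
- by rewrite size_cat size_iota ss [RHS]binS bin1.
move=> x; rewrite mem_cat => /orP[/sS[Sx xle]|].
  by split=> //; apply: leq_trans xle _; rewrite leq_mul2r; lia.
rewrite mem_iota => xE; split; last by rewrite [e + _]addnS mulSn; lia.
have -> : x = (e + d) * M.+1 - ((e + d) * M.+1 - x) by lia.
by apply: (proth_interval Me); rewrite -/M; lia.
Qed.

Lemma proth_frobenius_ge k n (M := k * 2 ^ n) : 0 < M ->
  (Posz (M * M) <= frobenius (proth_semigroup k n))%R.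
Proof.
move=> Mpos; have [_ above] := frobeniusP (proth_semigroup k n).
rewrite leNgt; apply/negP => /above[s Ss [sE]].
by apply: (proth_gap Mpos); rewrite -/M -sE.
Qed.

Lemma proth_frobenius_lt k n e (M := k * 2 ^ n) : M < 2 ^ e - 1 ->
  (frobenius (proth_semigroup k n) < Posz ((M + e) * M.+1))%R.
Proof.
move=> Me; have [gap _] := frobeniusP (proth_semigroup k n).
rewrite ltNge; apply/negP; case E: (frobenius _) => [x|//]; rewrite lez_nat => xge.
by apply: (gap x); [exact: proth_large Me xge|rewrite E].
Qed.

Lemma proth_embedding_dim_ge k n e : 0 < k -> 2 ^ e <= (k * 2 ^ n).+1 ->
  e.+1 <= embedding_dim (proth_semigroup k n).
Proof.
move=> kpos eM; rewrite /embedding_dim.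
rewrite -[e.+1](size_mkseq (fun i => k * 2 ^ (n + i) + 1)).
apply: fset_set_ge_size; first exact: minimal_generators_finite.
- apply: mkseq_uniq => i j /eqP.
  by rewrite eqn_add2r eqn_pmul2l // eqn_exp2l // eqn_add2l => /eqP.
- move=> x /mapP[i]; rewrite mem_iota /= => ie ->.
  rewrite minimal_generatorsE; apply: proth_generator_irreducible.
  by apply: leq_trans eM; rewrite leq_exp2l.
Qed.

Lemma proth_wilf_nu_ge k n e (M := k * 2 ^ n) :
  0 < M -> M < 2 ^ e - 1 -> e <= M ->
  'C((M - e).+1, 2) <= wilf_nu (proth_semigroup k n).
Proof.
move=> Mpos Me eM.
have [|s [us <- sS]] := @proth_small_elements k n e (M - e) Me.
  by rewrite subnKC.
apply: fset_set_ge_size us _; first exact: wilf_nu_finite.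
move=> x /sS[Sx xle]; split=> //.
apply: le_trans (proth_frobenius_ge Mpos); rewrite lez_nat.
(* [x + m <= M * m] means [x < M * M]. *)
by move: xle; rewrite subnKC // -/M mulnS; lia.
Qed.

Theorem theorem9 (n r : nat) (hn : (2 < n)%N) (hr : (1 <= r)%N)
    (hrn : (2 ^ r + 1 < 2 ^ n)%N) :
  let S := proth_semigroup (2 ^ r + 1) n in
  (frobenius S + 1 <= Posz (embedding_dim S * wilf_nu S))%R.
Proof.
cbv zeta; set S := proth_semigroup _ _.
(* As [2 ^ e <= M < 2 ^ e.+1 - 1], the number [e.+1] bounds both the coins needed and, from below,
   the embedding dimension. *)
pose e := n + r; pose M := (2 ^ r + 1) * 2 ^ n.
have ME : M = 2 ^ e + 2 ^ n by rewrite /M /e mulnDl mul1n -expnD [r + n]addnC.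
have n8 : 2 ^ 3 <= 2 ^ n by rewrite leq_exp2l.
have e2 : 2 * 2 ^ n <= 2 ^ e by rewrite -expnS leq_exp2l // /e; lia.
have e4 : 4 <= e by rewrite /e; lia.
have M5 : 5 * e.+1 <= M.+1.
  (* The base case [e = 4] only just holds: [25 = 16 + 8 + 1], with [8 <= 2 ^ n]. *)
  rewrite ME; elim: e e4 {e2 ME} => // d IH; rewrite leq_eqVlt => /orP[/eqP<-|].
    by lia.
  rewrite ltnS expnS => d4; have := IH d4.
  have : 2 ^ 4 <= 2 ^ d by rewrite leq_exp2l.
  by lia.
have Me : M < 2 ^ e.+1 - 1 by rewrite expnS; lia.
have lower : e.+1 * 'C((M - e.+1).+1, 2) <= embedding_dim S * wilf_nu S.
  apply: leq_mul; first by apply: proth_embedding_dim_ge; rewrite -/M; lia.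
  by apply: (proth_wilf_nu_ge _ Me); rewrite -/M; lia.
have := proth_frobenius_lt Me; have := triangle_bound (e4 : 5 <= e.+1) M5.
by rewrite -/S -/M; lia.
Qed.
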